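(* Let $d\ge1$ be an integer, let $q$ be a prime power with $\gcd(q,d+1)=1$, and let $e=\gcd(q-1,d+1)$. For $u\in\mathbb{F}_q^\times$ let $X_u$ be the hypersurface over $\mathbb{F}_q$ in $\mathbb{P}^d$ (homogeneous coordinates $y_1,\dots,y_{d+1}$) defined by $$y_1^{d+1}+\dots+y_{d+1}^{d+1}-u^{-1}(d+1)\,y_1\cdots y_{d+1}=0.$$ Let $\gamma=(-d-1,1,\dots,1)\in\mathbb{Z}^{d+2}$, and for $\lambda=(\lambda_1,\dots,\lambda_{d-1})\in(\mathbb{Z}/e\mathbb{Z})^{d-1}$ let $$\delta(\lambda)=(0,\lambda_1,\dots,\lambda_{d-1},-\lambda_1-\dots-\lambda_{d-1},0).$$ Then $$\#X_u(\mathbb{F}_q)=\frac{q^d-1}{q-1}-\sum_{\lambda\in(\mathbb{Z}/e\mathbb{Z})^{d-1}}g\!\left(\frac{q-1}{e}\,\delta(\lambda)\right)F_q\!\left(\gamma,\delta(\lambda),e\,\big|\,u^{d+1}\right).$$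
   Context: Put $q^\times=q-1$. Fix a non-trivial additive character $\psi:\mathbb{F}_q\to\mathbb{C}^\times$ and a multiplicative character $\chi:\mathbb{F}_q^\times\to\mathbb{C}^\times$ of order $q^\times$; $\chi^m(x)=\chi(x)^m$, $\zeta_k=e^{2\pi i/k}$. The Gauss sum is $g(m)=\sum_{u\in\mathbb{F}_q^\times}\psi(u)\chi^m(u)$ (it depends only on $m$ mod $q^\times$), and $g(v)=\prod_ig(v_i)$ for a vector $v$. A gamma triple $(\gamma,\delta,N)$ consists of $\gamma\in\mathbb{Z}^{d+2}$ with all components non-zero, $\sum_j\gamma_j=0$, $\gcd(\gamma_1,\dots,\gamma_{d+2})=1$; a vector $\delta\in\mathbb{Z}^{d+2}$ (only its class mod $N$ matters); and a positive integer $N$. Let $D(T)$ be the greatest common divisor in $\mathbb{C}[T]$ of $\prod_{\gamma_j<0}(T^{-\gamma_j}-\zeta_N^{\delta_j})$ and $\prod_{\gamma_j>0}(T^{\gamma_j}-\zeta_N^{-\delta_j})$, and let $s_\delta(m)$ be the multiplicity of $e^{2\pi im/q^\times}$ as a zero of $D(T)$. If $q$ is coprime to $\gamma_1\cdots\gamma_{d+2}$ and $N\mid q^\times$, then for $t\in\mathbb{F}_q^\times$ $$F_q(\gamma,\delta,N\mid t)=\frac{1}{1-q}\sum_{m=0}^{q^\times-1}\frac{g\left(-\gamma m+\frac{\delta}{N}q^\times\right)}{g\left(\frac{\delta}{N}q^\times\right)}\,q^{s_\delta(-m)-s_\delta(0)}\,\chi^m(\gamma^\gamma t),\qquad\gamma^\gamma=\prod_{j=1}^{d+2}\gamma_j^{\gamma_j}.$$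 *)

(* Defs.v *)
From mathcomp Require Import all_boot all_order all_algebra.
From mathcomp Require Import reals trigo.
From mathcomp.real_closed Require Import complex.

Set Implicit Arguments.
Unset Strict Implicit.
Unset Printing Implicit Defensive.

Import Order.TTheory GRing.Theory Num.Theory.
Local Open Scope ring_scope.

Section ComplexNumbers.
Variable R : realType.

Definition expi (x : R) : R[i] := Complex (cos x) (sin x).

(* e^(2 pi i m / k) *)
Definition root_of_unity (k : nat) (m : int) : R[i] :=
  expi (2 * pi * m%:~R / k%:R).

Definition zeta (k : nat) : R[i] := root_of_unity k 1.

End ComplexNumbers.

Section Characters.
Variables (F : finFieldType) (C : fieldType).

Definition additive_char (psi : F -> C) : Prop :=
  (forall x, psi x != 0) /\ {morph psi : x y / x + y >-> x * y}.

Definition nontrivial_char (psi : F -> C) : Prop := exists x, psi x != 1.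

(* Characters of the group F^* are represented by functions on F, of which only
   the values at nonzero elements are constrained or ever used. *)
Definition multiplicative_char (chi : F -> C) : Prop :=
  (forall x, x != 0 -> chi x != 0) /\
  (forall x y, x != 0 -> y != 0 -> chi (x * y) = chi x * chi y).

Definition char_power_trivial (chi : F -> C) (k : nat) : Prop :=
  forall x, x != 0 -> chi x ^+ k = 1.

Definition has_char_order (chi : F -> C) (n : nat) : Prop :=
  [/\ (0 < n)%N, char_power_trivial chi n
    & forall k, (0 < k)%N -> char_power_trivial chi k -> (n <= k)%N].

Definition gauss_sum (psi chi : F -> C) (m : int) : C :=
  \sum_(u : F | u != 0) psi u * chi u ^ m.

Definition gauss_prod (psi chi : F -> C) (n : nat) (v : 'I_n -> int) : C :=
  \prod_(i < n) gauss_sum psi chi (v i).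

End Characters.

Section GammaTriples.
Variables (d : nat) (gam del : 'I_d.+2 -> int) (N : nat).

Definition gamma_triple : Prop :=
  [/\ forall j, gam j != 0,
      \sum_j gam j = 0,
      \big[gcdn/0%N]_j `|gam j|%N = 1%N
    & (0 < N)%N].

(* The conditions under which [finite_hypergeometric] below is meant to be
   used over a field with [q] elements. *)
Definition admissible_gamma_triple (q : nat) : Prop :=
  [/\ gamma_triple, forall j, coprime q `|gam j|%N & (N %| q.-1)%N].

Variable R : realType.

(* For gam j < 0 the exponent `|gam j|%N is - gam j. *)
Definition negative_factor : {poly R[i]} :=
  \prod_(j | gam j < 0) ('X^(`|gam j|%N) - (zeta R N ^ del j)%:P).

Definition positive_factor : {poly R[i]} :=
  \prod_(j | 0 < gam j) ('X^(`|gam j|%N) - (zeta R N ^ (- del j))%:P).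

(* Defined up to a nonzero constant, which does not affect the zeros. *)
Definition D_poly : {poly R[i]} := gcdp negative_factor positive_factor.

Definition s_mult (q : nat) (m : int) : nat :=
  mup (root_of_unity R q.-1 m) D_poly.

Variables (F : finFieldType) (psi chi : F -> R[i]).

(* The vector (delta / N) (q - 1), which is integral when N divides q - 1. *)
Definition scaled_delta (j : 'I_d.+2) : int := del j * (#|F|.-1 %/ N)%N%:Z.

Definition gamma_gamma : F := \prod_j (gam j)%:~R ^ gam j.

Definition finite_hypergeometric (t : F) : R[i] :=
  let q := #|F| in
  (1 - q%:R)^-1 *
  \sum_(0 <= m < q.-1)
     gauss_prod psi chi (fun j => - gam j * m%:Z + scaled_delta j)
       / gauss_prod psi chi scaled_delta
     * q%:R ^ ((s_mult q (- m%:Z))%:Z - (s_mult q 0)%:Z)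
     * chi (gamma_gamma * t) ^+ m.

End GammaTriples.

Section ProjectiveHypersurface.
Variables (F : finFieldType) (d : nat).

Definition proj_point (y : 'rV[F]_d.+1) : {set 'rV[F]_d.+1} :=
  [set a *: y | a : F & a != 0].

Definition dwork_form (u : F) (y : 'rV[F]_d.+1) : F :=
  \sum_i y 0 i ^+ d.+1 - u^-1 * d.+1%:R * \prod_i y 0 i.

(* The F-rational points; the form is homogeneous, so its vanishing does not
   depend on the representative y. *)
Definition dwork_points (u : F) : {set {set 'rV[F]_d.+1}} :=
  [set proj_point y | y : 'rV[F]_d.+1 & (y != 0) && (dwork_form u y == 0)].

End ProjectiveHypersurface.

Definition dwork_gamma (d : nat) (j : 'I_d.+2) : int :=
  if j == ord0 then - (d.+1)%:Z else 1.

(* Z/eZ is represented by the residues 0, ..., e - 1, that is by 'I_e ('Z_e would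
   be wrong for e = 1). *)
Definition dwork_delta (d e : nat) (lam : {ffun 'I_d.-1 -> 'I_e})
    (j : 'I_d.+2) : int :=
  nth 0 (0 :: [seq (lam k)%:Z | k <- enum 'I_d.-1]
           ++ [:: - \sum_k (lam k)%:Z; 0]) j.

Lemma size_dwork_delta (d e : nat) (lam : {ffun 'I_d.-1 -> 'I_e}) :
  (0 < d)%N ->
  size (0 :: [seq (lam k)%:Z | k <- enum 'I_d.-1]
          ++ [:: - \sum_k (lam k)%:Z; 0]) = d.+2.
Proof.
by move=> d0; rewrite /= size_cat size_map size_enum_ord addn2 prednK.
Qed.

Lemma dwork_admissible (d e q : nat) :
  coprime q d.+1 -> e = gcdn q.-1 d.+1 ->
  admissible_gamma_triple (@dwork_gamma d) e q.
Proof.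
move=> cq ->; split; last exact: dvdn_gcdl.
  split; last by rewrite gcdn_gt0 orbT.
  - by move=> j; rewrite /dwork_gamma; case: ifP.
  - rewrite big_ord_recl /dwork_gamma eqxx (eq_bigr (fun=> 1)) //.
    by rewrite sumr_const card_ord -natz addNr.
  - rewrite big_ord_recl big_ord_recl /dwork_gamma /=.
    by rewrite gcd1n gcdn1.
move=> j; rewrite /dwork_gamma; case: ifP => _; last exact: coprimen1.
by rewrite abszN absz_nat.
Qed.

(* Main.v *)
Require Import Defs.
From mathcomp Require Import all_boot all_order all_algebra.
From mathcomp Require Import cyclic separable cyclotomic finfield reals trigo.
From mathcomp Require Import ring.
From mathcomp.real_closed Require Import complex.

Set Implicit Arguments.
Unset Strict Implicit.
Unset Printing Implicit Defensive.

Import Order.TTheory GRing.Theory Num.Theory.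
Import Defs.
Local Open Scope ring_scope.

(** Write q for the order of the field, N = q - 1, n = d + 1 and
    c = n / u. Both sides are reduced to one and the same sum over tuples
    k = (k_1, ..., k_n) of characters of the multiplicative group, identified
    with classes modulo N.

    Point count. Detecting the equation of the affine cone by the additive
    character gives

      q #{x | f(x) = 0} = q^n + sum_(s <> 0) sum_x psi (s f(x)),
      f(x) = sum_i x_i^n - c prod_i x_i.

    On the torus (all x_i nonzero) every value of psi is expanded in
    multiplicative characters by means of Gauss sums, and orthogonality leaves
    exactly the tuples with n k_i = sum_j k_j for all i, called balanced here;
    this is [sum_torus]. Off the torus the product term vanishes, and the sum
    is a difference of two products of one-variable sums. Because g(0) = -1,
    including x = 0 in a one-variable sum cancels its trivial character, so
    that the difference consists of the balanced tuples in which some k_i is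
    trivial ([sum_boundary]). Such tuples have sum_j k_j = 0, hence their
    contribution is N times the one they make on the torus. Altogether a
    balanced tuple is weighted by q if one of its entries is trivial and by 1
    otherwise ([card_form_zeros]).

    Hypergeometric side. A pair of a shift lambda and a summation index m gives
    the tuple k_i = m - (N / e) delta_i(lambda). Since e is the gcd of N and n,
    the n-torsion modulo N consists of the multiples of N / e, and these tuples
    are exactly the balanced ones, each obtained once ([sum_balanced]). The
    polynomial D divides T^n - 1, so its zeros are simple and the exponent s(-m)
    is 1 if some k_i is trivial and 0 otherwise ([s_mult_dwork]), while
    s(0) = 1: the power of q in the definition of the hypergeometric sum is,
    up to a factor q, the weight found in the point count
    ([hypergeometric_term]). *)

(** * Multiplicative characters and Gauss sums *)

Section Characters.
Variables (F : finFieldType) (C : numFieldType) (N' : nat).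
Notation N := N'.+1.
Hypothesis cardF : #|F| = N.+1.

Section Multiplicative.
Variable chi : F -> C.
Hypothesis chi_char : multiplicative_char chi.
Hypothesis chi_order : has_char_order chi N.

(** The characters of the multiplicative group, indexed by Z/N. The type 'I_N'.+1 is
    an additive group for every N, including N = 1 (that is, q = 2). *)
Definition mchar (k : 'I_N) (x : F) : C := chi x ^+ k.

Definition char_class (m : int) : 'I_N := inZp 1 *~ m.

Lemma char_class_nat (k : nat) : char_class k%:Z = inZp k.
Proof.
rewrite /char_class -pmulrn Zp_mulrn; apply: val_inj => /=.
by rewrite modnMml mul1n.
Qed.

Lemma char_class_ord (k : 'I_N) : char_class k%:Z = k.
Proof. by rewrite char_class_nat valZpK. Qed.

Lemma char_classD a b : char_class (a + b) = char_class a + char_class b.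
Proof. exact: mulrzDr. Qed.

Lemma char_classN a : char_class (- a) = - char_class a.
Proof. exact: mulrNz. Qed.

Lemma char_classMn a n : char_class (a * n%:Z) = char_class a *+ n.
Proof. by rewrite /char_class mulrzA -pmulrn. Qed.

Lemma char_class_sum (I : finType) (a : I -> int) :
  char_class (\sum_i a i) = \sum_i char_class (a i).
Proof.
exact: (big_morph char_class char_classD (mulr0z _)).
Qed.

Lemma char_class_eq0 (m : int) : (char_class m == 0) = (N %| m)%Z.
Proof.
have nat_case k : (char_class k%:Z == 0) = (N %| k)%N.
  by rewrite char_class_nat -val_eqE /=.
case: m => k; first exact: nat_case.
by rewrite NegzE char_classN oppr_eq0 nat_case dvdzE abszN absz_nat.
Qed.

Lemma chi1 : chi 1 = 1.
Proof.
case: chi_char => nz chiM; apply: (mulfI (nz 1 (oner_neq0 F))).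
by rewrite -chiM ?oner_neq0 // !mulr1.
Qed.

Lemma chiX x m : x != 0 -> chi (x ^+ m) = chi x ^+ m.
Proof.
move=> x0; elim: m => [|m IHm]; first exact: chi1.
by rewrite !exprS (chi_char.2 _ _ x0) ?IHm // expf_neq0.
Qed.

Lemma chi_expN x : x != 0 -> chi x ^+ N = 1.
Proof. by case: chi_order => _ + _; apply. Qed.

Lemma mchar0 x : mchar 0 x = 1. Proof. by []. Qed.

Lemma mchar1 k : mchar k 1 = 1.
Proof. by rewrite /mchar chi1 expr1n. Qed.

Lemma mchar_neq0 k x : x != 0 -> mchar k x != 0.
Proof. by move=> x0; rewrite expf_neq0 ?chi_char.1. Qed.

Lemma mcharM k x y : x != 0 -> y != 0 -> mchar k (x * y) = mchar k x * mchar k y.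
Proof. by move=> x0 y0; rewrite /mchar chi_char.2 // exprMn. Qed.

Lemma mcharV k x : x != 0 -> mchar k x^-1 = (mchar k x)^-1.
Proof.
move=> x0; apply: (mulfI (mchar_neq0 k x0)).
by rewrite -mcharM ?invr_neq0 // !mulfV ?mchar_neq0 // mchar1.
Qed.

Lemma mcharD k l x : x != 0 -> mchar (k + l) x = mchar k x * mchar l x.
Proof. by move=> x0; rewrite /mchar -exprD expr_mod ?chi_expN. Qed.

Lemma mcharN k x : x != 0 -> mchar (- k) x = (mchar k x)^-1.
Proof.
move=> x0; apply: (mulfI (mchar_neq0 k x0)).
by rewrite -mcharD // subrr mchar0 mulfV // mchar_neq0.
Qed.

Lemma mchar_sum (I : finType) (k : I -> 'I_N) x :
  x != 0 -> mchar (\sum_i k i) x = \prod_i mchar (k i) x.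
Proof. by move=> x0; apply: (big_morph (mchar^~ x)) => // a b; apply: mcharD. Qed.

Lemma mchar_prod (I : finType) k (x : I -> F) :
  (forall i, x i != 0) -> mchar k (\prod_i x i) = \prod_i mchar k (x i).
Proof.
move=> x0; suff []: mchar k (\prod_i x i) = \prod_i mchar k (x i) /\
    \prod_i x i != 0 by [].
elim/big_rec2: _ => [|i y z _ [IH y0]]; first by rewrite mchar1 oner_neq0.
by rewrite mcharM // IH mulf_neq0.
Qed.

Lemma mcharX k x m : x != 0 -> mchar k (x ^+ m) = mchar (k *+ m) x.
Proof.
move=> x0; elim: m => [|m IHm]; first exact: mchar1.
by rewrite exprS mulrS mcharM ?mcharD ?IHm // expf_neq0.
Qed.

Lemma mchar_class (m : int) x : x != 0 -> mchar (char_class m) x = chi x ^ m.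
Proof.
move=> x0; have nat_case k : mchar (char_class k%:Z) x = chi x ^+ k.
  by rewrite char_class_nat /mchar /= expr_mod ?chi_expN.
case: m => k; first exact: nat_case.
have -> : char_class (Negz k) = - char_class k.+1%:Z.
  by rewrite NegzE char_classN.
by rewrite mcharN // nat_case.
Qed.

Lemma exp_card_units (x : F) : x != 0 -> x ^+ N = 1.
Proof.
by move=> x0; apply: (mulfI x0); rewrite mulr1 -exprS -cardF expf_card.
Qed.

Lemma primitive_element : exists2 z : F, z != 0 & N.-primitive_root z.
Proof.
have sz : size (enum (predC1 (0 : F))) = N.
  by rewrite -cardE cardC1 cardF.
have /hasP [z] : has N.-primitive_root (enum (predC1 (0 : F))).
  apply: has_prim_root; rewrite ?enum_uniq ?sz //.
  apply/allP => x; rewrite mem_enum /= => x0.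
  by apply/unity_rootP; apply: exp_card_units.
by rewrite mem_enum; exists z.
Qed.

(** The values of chi at a generator z have order exactly N, since chi has order N;
    hence chi is injective on the powers of z. *)
Lemma chi_eq1 x : x != 0 -> (chi x == 1) = (x == 1).
Proof.
move=> x0; have [z z0 z_prim] := primitive_element.
have zlog (y : F) : y != 0 -> exists i : nat, y = z ^+ i.
  by move=> /exp_card_units /(prim_rootP z_prim) [i ->]; exists i.
have chi_dvd i : chi z ^+ i = 1 -> (N %| i)%N.
  move=> zi; rewrite /dvdn -leqn0 leqNgt; apply/negP => r_gt0.
  case: chi_order => _ _ /(_ _ r_gt0); rewrite leqNgt ltn_mod /=.
  suff triv : char_power_trivial chi (i %% N)%N by move=> /(_ triv).
  move=> y /zlog [j ->]; rewrite chiX // -exprM mulnC exprM.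
  suff -> : chi z ^+ (i %% N) = 1 by rewrite expr1n.
  by rewrite -[RHS]zi {2}(divn_eq i N) exprD mulnC exprM chi_expN // expr1n mul1r.
apply/eqP/eqP => [|->]; last exact: chi1.
have [i ->] := zlog x x0; rewrite chiX // => /chi_dvd.
by rewrite (prim_order_dvd z_prim) => /eqP.
Qed.

Lemma card_units_neq0 : N%:R != 0 :> C.
Proof. by rewrite pnatr_eq0. Qed.

Lemma reindex_unit_mul a (f : F -> C) :
  a != 0 -> \sum_(x | x != 0) f (a * x) = \sum_(x | x != 0) f x.
Proof.
move=> a0; rewrite [RHS](reindex_inj (mulfI a0)) /=.
by apply: eq_bigl => x; rewrite mulf_eq0 (negPf a0).
Qed.

(** For k nonzero, the sum is invariant under multiplication by mchar k z, which
    differs from 1 when z generates the group. *)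
Lemma sum_mchar_units k :
  \sum_(x : F | x != 0) mchar k x = if k == 0 then N%:R else 0.
Proof.
case: eqVneq => [->|k0].
  rewrite (eq_bigr (fun=> 1)) // sumr_const; congr (_ *+ _).
  by rewrite cardC1 cardF.
have [z z0 z_prim] := primitive_element.
have kz1 : mchar k z != 1.
  rewrite /mchar -chiX // chi_eq1 ?expf_neq0 // -(prim_order_dvd z_prim).
  by move: k0; apply: contra; rewrite -val_eqE /dvdn modn_small.
have zS : mchar k z * \sum_(x : F | x != 0) mchar k x =
    \sum_(x : F | x != 0) mchar k x.
  rewrite -[RHS](reindex_unit_mul (mchar k) z0) mulr_sumr.
  by apply: eq_bigr => x x0; rewrite mcharM.
move/eqP: zS; rewrite -subr_eq0 -{2}[\sum_(x | _) _]mul1r -mulrBl.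
by rewrite mulf_eq0 subr_eq0 (negPf kz1) => /eqP.
Qed.

Lemma sum_mchar x :
  x != 0 -> \sum_(k : 'I_N) mchar k x = if x == 1 then N%:R else 0.
Proof.
move=> x0; case: eqVneq => [->|x1].
  by rewrite (eq_bigr (fun=> 1)) => [|k _]; rewrite ?mchar1 // sumr_const card_ord.
have : (chi x - 1) * (\sum_(k < N) chi x ^+ k) = 0 by rewrite -subrX1 chi_expN ?subrr.
by move/eqP; rewrite mulf_eq0 subr_eq0 chi_eq1 // (negPf x1) => /eqP.
Qed.

Section Gauss.
Variable psi : F -> C.
Hypothesis psi_char : additive_char psi.
Hypothesis psi_nontrivial : nontrivial_char psi.

Lemma psi0 : psi 0 = 1.
Proof.
by apply: (mulfI (psi_char.1 0)); rewrite -psi_char.2 addr0 mulr1.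
Qed.

Lemma psi_sum (I : finType) (x : I -> F) : psi (\sum_i x i) = \prod_i psi (x i).
Proof. exact: (big_morph psi psi_char.2 psi0). Qed.

Lemma sum_psi a : \sum_(x : F) psi (a * x) = if a == 0 then N.+1%:R else 0.
Proof.
case: eqVneq => [->|a0].
  rewrite (eq_bigr (fun=> 1)) => [|x _]; last by rewrite mul0r psi0.
  by rewrite sumr_const cardF.
have -> : \sum_x psi (a * x) = \sum_x psi x.
  by rewrite [RHS](reindex_inj (mulfI a0)).
have [y y1] := psi_nontrivial.
have yS : psi y * \sum_x psi x = \sum_x psi x.
  rewrite [RHS](reindex_inj (addrI y)) mulr_sumr.
  by apply: eq_bigr => x _; rewrite psi_char.2.
move/eqP: yS; rewrite -subr_eq0 -{2}[\sum_x _]mul1r -mulrBl mulf_eq0.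
by rewrite subr_eq0 (negPf y1) => /eqP.
Qed.

Lemma sum_psi_units a : a != 0 -> \sum_(x : F | x != 0) psi (a * x) = -1.
Proof.
move=> a0; have := sum_psi a; rewrite (negPf a0) (bigD1 0) //= mulr0 psi0.
by move/eqP; rewrite addrC addr_eq0 => /eqP.
Qed.

Definition gauss (k : 'I_N) : C := gauss_sum psi chi k%:Z.

Lemma gaussE k : gauss k = \sum_(x | x != 0) psi x * mchar k x.
Proof. by []. Qed.

Lemma gauss_sum_class m : gauss_sum psi chi m = gauss (char_class m).
Proof. by apply: eq_bigr => x x0; rewrite -mchar_class. Qed.

Lemma gauss0 : gauss 0 = -1.
Proof.
rewrite -(sum_psi_units (oner_neq0 F)).
by apply: eq_bigr => x x0; rewrite mul1r mulr1.
Qed.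

(** If gauss k vanished, then so would the Fourier transform of the function mchar k
    (extended by 0) at every point: its value at a is a multiple of gauss k, or
    is 0 by orthogonality if a = 0. Fourier inversion at 1 then gives q = 0. *)
Lemma gauss_neq0 k : gauss k != 0.
Proof.
have [->|k0] := eqVneq k 0; first by rewrite gauss0 oppr_eq0 oner_neq0.
have twist a : \sum_(x : F | x != 0) psi (a * x) * mchar k x =
    if a == 0 then 0 else (mchar k a)^-1 * gauss k.
  case: eqVneq => [->|a0].
    rewrite (eq_bigr (mchar k)) => [|x _]; last by rewrite mul0r psi0 mul1r.
    by rewrite sum_mchar_units (negPf k0).
  rewrite gaussE -[in RHS](reindex_unit_mul _ a0) mulr_sumr.
  apply: eq_bigr => x x0; rewrite mulrCA; congr (_ * _).
  by rewrite mcharM // mulKf // mchar_neq0.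
apply/eqP => g0.
have : \sum_(a : F) psi (- a) * \sum_(x | x != 0) psi (a * x) * mchar k x = 0.
  by apply: big1 => a _; rewrite twist g0 mulr0 if_same mulr0.
under eq_bigr do rewrite mulr_sumr.
rewrite exchange_big /= (bigD1 1) ?oner_neq0 //= [X in _ + X]big1.
  rewrite addr0 (eq_bigr (fun=> 1)) => [|a _].
    by rewrite sumr_const cardF => /eqP; rewrite pnatr_eq0.
  by rewrite mulrA -psi_char.2 mulr1 addNr psi0 mchar1 mulr1.
move=> x /andP [x0 x1].
rewrite (eq_bigr (fun a => psi ((x - 1) * a) * mchar k x)) => [|a _].
  by rewrite -mulr_suml sum_psi subr_eq0 (negPf x1) mul0r.
by rewrite mulrA -psi_char.2 mulrBl mul1r addrC [a * x]mulrC.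
Qed.

(** Fourier inversion on the multiplicative group, applied to the restriction of
    psi. *)
Lemma psi_inversion x :
  x != 0 -> psi x = N%:R^-1 * \sum_(k : 'I_N) gauss (- k) * mchar k x.
Proof.
move=> x0; apply: (mulfI card_units_neq0); rewrite mulVKf ?card_units_neq0 //.
under eq_bigr do rewrite gaussE mulr_suml.
rewrite exchange_big (bigD1 x) //= [X in _ = _ + X]big1 ?addr0.
  under eq_bigr => k _.
    rewrite -mulrA mcharN // mulVf ?mchar_neq0 //.
    over.
  by rewrite sumr_const card_ord mulr_natl mulr1.
move=> y /andP [y0 yx].
rewrite (eq_bigr (fun k => psi y * mchar k (y^-1 * x))) => [|k _].
  rewrite -mulr_sumr sum_mchar ?mulf_neq0 ?invr_neq0 //.
  case: eqP => [/(canRL (mulKf (invr_neq0 y0)))|_]; last by rewrite mulr0.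
  by rewrite invrK mulr1 => xy; rewrite xy eqxx in yx.
by rewrite -mulrA mcharN // mcharM ?invr_neq0 // mcharV.
Qed.

(** Expanding psi (s x^n) by [psi_inversion], the sum over x selects the
    characters whose n-th power is inverse to mchar l. *)
Lemma sum_psi_monomial n s l : s != 0 ->
  \sum_(x : F | x != 0) psi (s * x ^+ n) * mchar l x =
  \sum_(k : 'I_N | k *+ n + l == 0) gauss (- k) * mchar k s.
Proof.
move=> s0; transitivity (\sum_(x : F | x != 0) N%:R^-1 *
    \sum_(k : 'I_N) gauss (- k) * mchar k s * mchar (k *+ n + l) x).
  apply: eq_bigr => x x0.
  rewrite psi_inversion ?mulf_neq0 ?expf_neq0 // -mulrA mulr_suml; congr (_ * _).
  apply: eq_bigr => k _.
  by rewrite mcharM ?expf_neq0 // mcharX // mcharD // !mulrA.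
rewrite -mulr_sumr exchange_big /= [in RHS]big_mkcond /= mulr_sumr.
apply: eq_bigr => k _; rewrite -mulr_sumr sum_mchar_units.
case: eqP => _; last by rewrite !mulr0.
by rewrite mulrC mulfK // card_units_neq0.
Qed.

(** Expanding the product into a sum over tuples k, the sum over s selects the
    tuples whose product of characters is inverse to mchar l. *)
Lemma sum_prod_characters n (P : pred 'I_N) l :
  \sum_(s : F | s != 0) mchar l s *
     \prod_(i < n) \sum_(k | P k) gauss (- k) * mchar k s =
  N%:R * \sum_(k : {ffun 'I_n -> 'I_N} |
             [forall i, P (k i)] && (\sum_i k i + l == 0))
           \prod_i gauss (- k i).
Proof.
transitivity (\sum_(s : F | s != 0) \sum_(k : {ffun 'I_n -> 'I_N} | k \in ffun_on P)
    (\prod_i gauss (- k i)) * mchar (\sum_i k i + l) s).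
  apply: eq_bigr => s s0; rewrite bigA_distr_big mulr_sumr.
  apply: eq_bigr => k _; rewrite mcharD // mchar_sum // big_split /= mulrC.
  by rewrite mulrA.
rewrite exchange_big /= big_mkcondr /= mulr_sumr.
apply: eq_big => [k|k _]; first by apply/ffun_onP/forallP.
rewrite -mulr_sumr sum_mchar_units.
by case: eqP; rewrite ?mulr0 // mulrC.
Qed.

(** * Zeros of the affine form *)

Section Counting.
Variable n : nat.
Variable c : F.
Hypothesis n_gt0 : (0 < n)%N.
Hypothesis c_neq0 : c != 0.

Definition affine_form (x : {ffun 'I_n -> F}) : F := \sum_i x i ^+ n - c * \prod_i x i.

Definition torus (x : {ffun 'I_n -> F}) := [forall i, x i != 0].

(** The tuples that survive on the torus: k_0 being the character that comes from the
    product term, orthogonality in x_i gives n k_i = - k_0 and orthogonality in s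
    gives sum_j k_j = - k_0. *)
Definition balanced (k : {ffun 'I_n -> 'I_N}) :=
  [forall i, k i *+ n == \sum_j k j].

(** The index l below is the character k_0 that comes from psi (- s c prod_i x_i). *)
Lemma sum_torus :
  \sum_(s | s != 0) \sum_(x | torus x) psi (s * affine_form x) =
  \sum_(k | balanced k) gauss (\sum_i k i) * mchar (- \sum_i k i) (- c) *
     \prod_i gauss (- k i).
Proof.
transitivity (N%:R^-1 * \sum_(l : 'I_N) gauss (- l) * mchar l (- c) *
    \sum_(s | s != 0) mchar l s * \prod_(i < n)
      \sum_(x | x != 0) psi (s * x ^+ n) * mchar l x).
  transitivity (\sum_(s | s != 0) \sum_(x | torus x) N%:R^-1 * \sum_l
      gauss (- l) * mchar l (- c) * (mchar l s *
        \prod_i (psi (s * x i ^+ n) * mchar l (x i)))).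
    apply: eq_bigr => s s0; apply: eq_bigr => x /forallP x0.
    have -> : s * affine_form x = (s * - c) * \prod_i x i + \sum_i s * x i ^+ n.
      by rewrite /affine_form mulrBr mulr_sumr addrC mulrN mulNr mulrA.
    rewrite psi_char.2 psi_sum psi_inversion; last first.
      by rewrite !mulf_neq0 ?oppr_eq0 //; apply/prodf_neq0.
    rewrite -[LHS]mulrA; congr (_ * _); rewrite mulr_suml; apply: eq_bigr => l _.
    rewrite !mcharM ?mulf_neq0 ?oppr_eq0 //; last exact/prodf_neq0.
    rewrite mchar_prod // big_split /=; ring.
  under eq_bigr do rewrite -mulr_sumr exchange_big.
  rewrite -mulr_sumr exchange_big; congr (_ * _); apply: eq_bigr => l _.
  rewrite mulr_sumr; apply: eq_bigr => s s0.
  rewrite bigA_distr_big -!mulr_sumr; congr (_ * (_ * _)).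
transitivity (\sum_(l : 'I_N) \sum_(k : {ffun 'I_n -> 'I_N} |
    [forall i, k i *+ n + l == 0] && (\sum_i k i + l == 0))
    gauss (- l) * mchar l (- c) * \prod_i gauss (- k i)).
  rewrite mulr_sumr; apply: eq_bigr => l _.
  under [X in _ * (_ * X)]eq_bigr => s s0.
    under eq_bigr do rewrite sum_psi_monomial //.
    over.
  rewrite sum_prod_characters mulrCA mulKf ?card_units_neq0 //.
  by rewrite mulr_sumr.
rewrite (exchange_big_dep predT) //= [RHS]big_mkcond /=.
apply: eq_bigr => k _.
have -> : balanced k = [forall i, k i *+ n + (- \sum_j k j) == 0].
  by apply: eq_forallb => i; rewrite subr_eq0.
rewrite (big_mkcond (fun l => _ && _)) (bigD1 (- \sum_i k i)) //=.
rewrite addrN eqxx andbT opprK [X in _ + X]big1 ?addr0 // => l.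
case: ifP => // /andP [_ /eqP kl] /negP []; apply/eqP.
by apply: (addrI (\sum_i k i)); rewrite kl addrN.
Qed.

(** When a coordinate vanishes, the form is a sum of n-th powers. A one-variable sum
    over F differs from the one over the units by its term 1 at x = 0, which
    cancels the term - 1 of the trivial character; so all points contribute the
    tuples without trivial entry, and the torus contributes all tuples. *)
Lemma sum_boundary :
  \sum_(s | s != 0) \sum_(x | ~~ torus x) psi (s * affine_form x) =
  - N%:R * \sum_(k | balanced k && [exists i, k i == 0])
     \prod_i gauss (- k i).
Proof.
have full s : s != 0 ->
    \sum_(x : F) psi (s * x ^+ n) =
    \sum_(k : 'I_N | (k *+ n == 0) && (k != 0)) gauss (- k) * mchar k s.
  move=> s0; have := sum_psi_monomial n 0 s0.
  rewrite (eq_bigl (fun k : 'I_N => k *+ n == 0)) => [|k]; last by rewrite addr0.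
  rewrite [in RHS](bigD1 0) ?mul0rn //= oppr0 gauss0 mulr1 => units.
  rewrite (bigD1 0) //= expr0n eqn0Ngt n_gt0 mulr0 psi0.
  under eq_bigr => x _ do rewrite -[psi _]mulr1 -(mchar0 x).
  by rewrite units addNKr.
transitivity (\sum_(s | s != 0) (\prod_(i < n) \sum_(x : F) psi (s * x ^+ n) -
    \prod_(i < n) \sum_(x : F | x != 0) psi (s * x ^+ n) * mchar 0 x)).
  apply: eq_bigr => s s0; rewrite bigA_distr_bigA bigA_distr_big.
  have -> : \sum_(x : {ffun 'I_n -> F} | x \in ffun_on (predC1 0))
      \prod_i (psi (s * x i ^+ n) * mchar 0 (x i)) =
      \sum_(x : {ffun 'I_n -> F} | torus x) \prod_i psi (s * x i ^+ n).
    apply: eq_big => [x|x _]; first by apply/ffun_onP/forallP.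
    by apply: eq_bigr => i _; rewrite mulr1.
  rewrite [X in _ = X - _](bigID torus) /= addrAC subrr add0r; apply: eq_bigr => x.
  case/forallPn => i; rewrite negbK => /eqP xi0.
  rewrite -psi_sum -mulr_sumr /affine_form (bigD1 i) //= [in X in _ - X](bigD1 i) //=.
  by rewrite xi0 mul0r mulr0 subr0.
rewrite big_split /= sumrN.
transitivity (N%:R * (\sum_(k : {ffun 'I_n -> 'I_N} |
      [forall i, (k i *+ n == 0) && (k i != 0)] && (\sum_i k i + 0 == 0))
      \prod_i gauss (- k i)) -
    N%:R * (\sum_(k : {ffun 'I_n -> 'I_N} |
      [forall i, k i *+ n + 0 == 0] && (\sum_i k i + 0 == 0))
      \prod_i gauss (- k i))).
  rewrite -(sum_prod_characters n (fun k => (k *+ n == 0) && (k != 0)) 0).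
  rewrite -(sum_prod_characters n (fun k => k *+ n + 0 == 0) 0).
  congr (_ - _); apply: eq_bigr => s s0.
    by rewrite mchar0 mul1r; apply: eq_bigr => i _; apply: full.
  by rewrite mchar0 mul1r; apply: eq_bigr => i _; apply: sum_psi_monomial.
rewrite -mulrBr mulNr -mulrN; congr (_ * _).
rewrite [X in _ - X](bigID (fun k : {ffun _ -> _} => [exists i, k i == 0])) /=.
(* A trivial entry k_j forces sum_i k_i = n k_j = 0. *)
have balancedE (k : {ffun 'I_n -> 'I_N}) : balanced k && [exists i, k i == 0] =
    [forall i, k i *+ n + 0 == 0] && (\sum_i k i + 0 == 0) && [exists i, k i == 0].
  case: existsP => [[j /eqP kj0]|_]; rewrite ?andbF // !andbT addr0.
  apply/forallP/andP => [bal|[/forallP kn /eqP ->] i].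
    have sum0 : \sum_i k i = 0 by rewrite -(eqP (bal j)) kj0 mul0rn.
    by rewrite sum0 eqxx; split=> //; apply/forallP => i; rewrite addr0 -sum0.
  by rewrite -[k i *+ n]addr0.
rewrite (eq_bigl _ _ balancedE) opprD addrCA.
rewrite [X in _ + (X - _)](eq_bigl (fun k : {ffun 'I_n -> 'I_N} =>
  [forall i, k i *+ n + 0 == 0] && (\sum_i k i + 0 == 0) &&
  ~~ [exists i, k i == 0])) ?subrr ?addr0 // => k.
rewrite negb_exists andbAC; congr (_ && _).
apply/forallP/andP => [kn|[/forallP kn /forallP k0] i].
  by split; apply/forallP => i; have /andP [] := kn i; rewrite ?addr0.
by rewrite -[k i *+ n]addr0 kn k0.
Qed.

Definition gauss_summand (k : {ffun 'I_n -> 'I_N}) : C :=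
  gauss (\sum_i k i) * mchar (- \sum_i k i) (- c) * \prod_i gauss (- k i).

Lemma card_form_zeros :
  N.+1%:R * #|[set x | affine_form x == 0]|%:R =
  N.+1%:R ^+ n + \sum_(k | balanced k)
     gauss_summand k * N.+1%:R ^+ [exists i, k i == 0].
Proof.
transitivity (\sum_(x : {ffun 'I_n -> F}) \sum_s psi (s * affine_form x)).
  rewrite -sum1_card natr_sum mulr_sumr big_mkcond /=; apply: eq_bigr => x _.
  rewrite inE mulr1 -sum_psi.
  by apply: eq_bigr => s _; rewrite mulrC.
rewrite exchange_big (bigD1 0) //=; congr (_ + _).
  rewrite (eq_bigr (fun=> 1)) => [|x _]; last by rewrite mul0r psi0.
  by rewrite sumr_const card_ffun cardF card_ord natrX.
under eq_bigr do rewrite (bigID torus) /=.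
rewrite big_split /= sum_torus sum_boundary -/(gauss_summand _).
rewrite mulNr -mulrN -sumrN big_mkcondr mulr_sumr -big_split /=.
apply: eq_bigr => k /forallP bal; case: existsP => [[j /eqP kj0]|_].
  have sum0 : \sum_i k i = 0 by rewrite -(eqP (bal j)) kj0 mul0rn.
  rewrite /gauss_summand sum0 oppr0 gauss0 mchar0 expr1 -[N.+1%:R]natr1; ring.
by rewrite expr0 mulr0 addr0 mulr1.
Qed.

End Counting.
End Gauss.
End Multiplicative.
End Characters.

(** * From affine to projective points *)

Section ProjectiveCount.
Variables (F : finFieldType) (d : nat) (u : F).

Lemma dwork_formZ a (y : 'rV[F]_d.+1) :
  dwork_form u (a *: y) = a ^+ d.+1 * dwork_form u y.
Proof.
rewrite /dwork_form mulrBr mulr_sumr; congr (_ - _).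
  by apply: eq_bigr => i _; rewrite mxE exprMn.
rewrite [RHS]mulrCA; congr (_ * _).
under eq_bigr do rewrite mxE.
by rewrite big_split /= prodr_const card_ord.
Qed.

Lemma card_proj_point (y : 'rV[F]_d.+1) : y != 0 -> #|proj_point y| = #|F|.-1.
Proof.
move=> y0; rewrite card_in_imset => [|a b _ _ /eqP].
  by rewrite -(cardC1 (0 : F)); apply: eq_card => a; rewrite !inE.
by rewrite -subr_eq0 -scalerBl scaler_eq0 (negPf y0) orbF subr_eq0 => /eqP.
Qed.

Lemma eq_proj_point (x y : 'rV[F]_d.+1) :
  (proj_point x == proj_point y) = (x \in proj_point y).
Proof.
apply/eqP/imsetP => [xy|[a]].
  have : x \in proj_point x by apply/imsetP; exists 1; rewrite ?inE ?scale1r ?oner_neq0.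
  by rewrite xy => /imsetP [a]; exists a.
rewrite inE => a0 ->; apply/setP => z; apply/imsetP/imsetP => -[b].
  rewrite inE => b0 ->; exists (b * a); first by rewrite inE mulf_neq0.
  by rewrite scalerA.
rewrite inE => b0 ->; exists (b / a); first by rewrite inE mulf_neq0 ?invr_neq0.
by rewrite scalerA divfK.
Qed.

(** The affine cone is the origin together with one orbit of N points over each
    projective point. *)
Lemma card_dwork_points :
  (#|dwork_points d u| * #|F|.-1)%N.+1 =
  #|[set x : {ffun 'I_d.+1 -> F} | affine_form (u^-1 * d.+1%:R) x == 0]|.
Proof.
transitivity #|[set y : 'rV[F]_d.+1 | dwork_form u y == 0]|.
  have form0 : dwork_form u (0 : 'rV_d.+1) = 0.
    by rewrite -[X in dwork_form u X](scale0r 0) dwork_formZ expr0n mul0r.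
  rewrite (cardsD1 0) inE form0 eqxx add1n; congr _.+1.
  set V := _ :\ _; have VE : V = [set y | (y != 0) && (dwork_form u y == 0)].
    by apply/setP => y; rewrite !inE.
  rewrite -[RHS]sum1_card (partition_big_imset (@proj_point F d)) /=.
  rewrite -sum_nat_const /dwork_points -VE; apply: eq_bigr => P.
  case/imsetP => y yV ->; move: yV; rewrite VE inE => /andP [y0 fy].
  rewrite -(card_proj_point y0) -sum1_card; apply: eq_bigl => x.
  rewrite eq_proj_point andb_idl // => /imsetP [a]; rewrite inE => a0 ->.
  by rewrite inE scaler_eq0 (negPf a0) y0 dwork_formZ (eqP fy) mulr0 /=.
pose row_of (x : {ffun 'I_d.+1 -> F}) : 'rV[F]_d.+1 := \row_i x i.
have row_inj : injective row_of.
  by move=> x y /rowP xy; apply/ffunP => i; have := xy i; rewrite !mxE.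
rewrite -(card_imset _ row_inj); apply: eq_card => y; rewrite inE.
have formE x : dwork_form u (row_of x) = affine_form (u^-1 * d.+1%:R) x.
  rewrite /dwork_form /affine_form; congr (_ - _ * _).
    by apply: eq_bigr => i _; rewrite mxE.
  by apply: eq_bigr => i _; rewrite mxE.
apply/eqP/imsetP => [fy|[x]]; last by rewrite inE -formE => /eqP fx ->.
have yE : y = row_of [ffun i => y 0 i] by apply/rowP => i; rewrite !mxE ffunE.
by exists [ffun i => y 0 i] => //; rewrite inE -formE -yE fy.
Qed.

End ProjectiveCount.

(** * Complex roots of unity and the multiplicities s *)

Section RootsOfUnity.
Variable R : realType.

Lemma expiD (x y : R) : expi (x + y) = expi x * expi y.
Proof.
rewrite /expi cosD sinD; apply/eqP.
by rewrite eq_complex /= eqxx addrC eqxx.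
Qed.

Lemma expi0 : expi (0 : R) = 1.
Proof. by rewrite /expi cos0 sin0. Qed.

Lemma root_of_unityD k (a b : int) :
  root_of_unity R k (a + b) = root_of_unity R k a * root_of_unity R k b.
Proof. by rewrite /root_of_unity -expiD intrD mulrDr mulrDl. Qed.

Lemma root_of_unity0 k : root_of_unity R k 0 = 1.
Proof. by rewrite /root_of_unity mulr0 mul0r expi0. Qed.

Lemma root_of_unity_neq0 k a : root_of_unity R k a != 0.
Proof.
apply: contraTneq (oner_neq0 R[i]) => a0.
by rewrite -(root_of_unity0 k) -(addrN a) root_of_unityD a0 mul0r eqxx.
Qed.

Lemma root_of_unityN k a : root_of_unity R k (- a) = (root_of_unity R k a)^-1.
Proof.
apply: (mulIf (root_of_unity_neq0 k a)).
by rewrite -root_of_unityD addNr root_of_unity0 mulVf // root_of_unity_neq0.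
Qed.

Lemma root_of_unityX k a (b : int) :
  root_of_unity R k (a * b) = root_of_unity R k a ^ b.
Proof.
have nat_case (j : nat) : root_of_unity R k (a * j%:Z) = root_of_unity R k a ^+ j.
  elim: j => [|j IHj]; first by rewrite mulr0 root_of_unity0.
  by rewrite -addn1 PoszD mulrDr root_of_unityD IHj mulr1 addn1 exprSr.
case: b => j; first exact: nat_case.
by rewrite NegzE mulrN root_of_unityN nat_case.
Qed.

Lemma zetaX k (m : int) : zeta R k ^ m = root_of_unity R k m.
Proof. by rewrite -root_of_unityX mul1r. Qed.

Lemma root_of_unity_mull r k (m : int) : (0 < r)%N ->
  root_of_unity R (r * k) (r%:Z * m) = root_of_unity R k m.
Proof.
move=> r0; rewrite /root_of_unity natrM intrM -[r%:Z%:~R]/(r%:R : R).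
by rewrite mulrCA -mulf_div divff ?mul1r // pnatr_eq0 -lt0n.
Qed.

(** By periodicity m may be reduced modulo k. If 0 < m < k, let y = pi m / k; then
    cos (2 y) = 1 - 2 sin(y)^2 < 1 because 0 < y < pi. *)
Lemma root_of_unity_eq1 k (m : int) : (0 < k)%N ->
  (root_of_unity R k m == 1) = (k %| m)%Z.
Proof.
move=> k0; have kR0 : k%:R != 0 :> R by rewrite pnatr_eq0 -lt0n.
have root_k : root_of_unity R k k%:Z = 1.
  by rewrite /root_of_unity mulfK // mulr_natl /expi cos2pi sin2pi.
have -> : root_of_unity R k m = root_of_unity R k (m %% k)%Z.
  rewrite {1}(divz_eq m k) mulrC root_of_unityD root_of_unityX root_k.
  by rewrite exp1rz mul1r.
have -> : (k %| m)%Z = (k %| m %% k)%Z.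
  by apply/dvdz_mod0P/dvdz_mod0P; rewrite modz_mod.
have kZ0 : k%:Z != 0 by rewrite eqz_nat -lt0n.
have := ltz_mod m kZ0.
have [r ->] : exists r : nat, (m %% k)%Z = r%:Z.
  by exists `|(m %% k)%Z|%N; rewrite gez0_abs // modz_ge0.
rewrite ltz_nat => r_lt.
case: r r_lt => [|r] r_lt; first by rewrite root_of_unity0 eqxx dvdz0.
rewrite dvdzE /= gtnNdvd //; apply/negbTE.
pose y : R := pi * r.+1%:R / k%:R.
have siny : 0 < sin y.
  apply: sin_gt0_pi.
  rewrite divr_gt0 ?mulr_gt0 ?pi_gt0 ?ltr0n //=.
  by rewrite ltr_pdivrMr ?ltr0n // ltr_pM2l ?pi_gt0 // ltr_nat.
rewrite /root_of_unity.
have -> : 2 * pi * r.+1%:Z%:~R / k%:R = y *+ 2 :> R.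
  by rewrite /y -[r.+1%:Z%:~R]/(r.+1%:R : R) -[RHS]mulr_natl !mulrA.
rewrite eq_complex /= cos_mulr2n negb_and; apply/orP; left.
rewrite -subr_eq0 -addrA -opprD -mulr2n -mulrnBl mulrn_eq0 /=.
by rewrite -(cos2Dsin2 y) opprD addNKr oppr_eq0 sqrf_eq0 gt_eqF.
Qed.
End RootsOfUnity.

Lemma mup_leq1_separable (K : fieldType) (p : {poly K}) z :
  p != 0 -> separable_poly p -> (mup z p <= 1)%N.
Proof.
move=> p0 /separable_polyP [sep _].
rewrite mup_leq //; apply/negP; rewrite expr2 => /sep.
by rewrite coprimep_XsubC root_XsubC eqxx.
Qed.

Section DworkDelta.
Variables (d e : nat).

Lemma dwork_delta_ord0 (lam : {ffun 'I_d.-1 -> 'I_e}) : dwork_delta lam ord0 = 0.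
Proof. by []. Qed.

(** The last n entries of delta, those that go with the entries 1 of gamma. *)
Definition dwork_shift (lam : {ffun 'I_d.-1 -> 'I_e}) (i : 'I_d.+1) : int :=
  dwork_delta lam (lift ord0 i).

Lemma dwork_shiftE lam i : dwork_shift lam i =
  nth 0 ([seq (lam k)%:Z | k <- enum 'I_d.-1] ++ [:: - \sum_k (lam k)%:Z; 0]) i.
Proof. by []. Qed.

Hypothesis d_gt0 : (0 < d)%N.

Lemma dwork_shift_lam lam (j : 'I_d.-1) (i : 'I_d.+1) :
  i = j :> nat -> dwork_shift lam i = lam j.
Proof.
move=> ij; rewrite dwork_shiftE nth_cat size_map size_enum_ord ij ltn_ord.
by rewrite (nth_map j) ?size_enum_ord // nth_ord_enum.
Qed.

Lemma dwork_shift_last lam : dwork_shift lam ord_max = 0.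
Proof.
rewrite dwork_shiftE nth_cat size_map size_enum_ord /=.
rewrite ltnNge leq_pred /=.
by have -> : (d - d.-1 = 1)%N by rewrite -{1}(prednK d_gt0) subSnn.
Qed.

Lemma sum_dwork_shift lam : \sum_i dwork_shift lam i = 0.
Proof.
under eq_bigr do rewrite dwork_shiftE.
set s := _ ++ _; have sz : size s = d.+1.
  by rewrite size_cat size_map size_enum_ord /= addn2 prednK.
rewrite -(big_mkord xpredT (fun i => nth 0 s i)) -sz.
rewrite -(big_nth 0 xpredT id) /s big_cat big_map big_enum /=.
by rewrite big_cons big_seq1 addr0 addrN.
Qed.

End DworkDelta.

Section Multiplicity.
Variables (R : realType) (d e r : nat) (lam : {ffun 'I_d.-1 -> 'I_e}).
Hypotheses (r_gt0 : (0 < r)%N) (e_gt0 : (0 < e)%N) (e_dvd : (e %| d.+1)%N).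

Lemma dwork_negative_factor :
  negative_factor (@dwork_gamma d) (dwork_delta lam) e R = 'X^(d.+1) - 1.
Proof.
rewrite /negative_factor (bigD1 ord0) //= big1 ?mulr1.
  by rewrite dwork_delta_ord0 expr0z.
by move=> j /andP [+ j0]; rewrite /dwork_gamma (negPf j0).
Qed.

Lemma dwork_positive_factor :
  positive_factor (@dwork_gamma d) (dwork_delta lam) e R =
  \prod_(i < d.+1) ('X - (zeta R e ^ (- dwork_shift lam i))%:P).
Proof.
rewrite /positive_factor big_mkcond [LHS]big_ord_recl /= mul1r.
by apply: eq_bigr => i _.
Qed.

(** A zero of the positive factor is a power of zeta_e, hence an n-th root of unity
    because e divides n; so D has the same zeros as the positive factor, and they
    are simple because D divides the separable polynomial T^n - 1. *)
Lemma s_mult_dwork (m : int) :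
  s_mult (@dwork_gamma d) (dwork_delta lam) e R (r * e).+1 m =
  [exists i, ((r * e)%N %| m + r%:Z * dwork_shift lam i)%Z].
Proof.
have re_gt0 : (0 < r * e)%N by rewrite muln_gt0 r_gt0.
rewrite /s_mult /D_poly dwork_negative_factor dwork_positive_factor /=.
set z := root_of_unity _ _ _; set P := \prod_i _.
have factorE i : ((r * e)%N %| m + r%:Z * dwork_shift lam i)%Z =
    (z == zeta R e ^ (- dwork_shift lam i)).
  rewrite -(root_of_unity_eq1 R) // root_of_unityD root_of_unity_mull //.
  rewrite zetaX root_of_unityN.
  have nz : root_of_unity R e (dwork_shift lam i) != 0.
    exact: root_of_unity_neq0.
  by rewrite (can2_eq (mulfK nz) (mulfVK nz)) mul1r.
have rootP : root P z = [exists i, ((r * e)%N %| m + r%:Z * dwork_shift lam i)%Z].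
  rewrite /P /root horner_prod; apply/prodf_eq0/existsP => -[j].
    by rewrite hornerXsubC subr_eq0 -factorE; exists j.
  by rewrite factorE => zE; exists j; rewrite // hornerXsubC subr_eq0.
have n0 : d.+1%:R != 0 :> R[i] by rewrite pnatr_eq0.
have sep := separable_Xn_sub_1 n0.
have D0 : gcdp ('X^(d.+1) - 1) P != 0.
  by rewrite gcdp_eq0 negb_and -size_poly_eq0 size_XnsubC.
have mup_le1 : (mup z (gcdp ('X^(d.+1) - 1) P) <= 1)%N.
  by apply: mup_leq1_separable => //; apply: dvdp_separable (dvdp_gcdl _ _) sep.
have mup_root : (0 < mup z (gcdp ('X^(d.+1) - 1) P))%N = root P z.
  rewrite -XsubC_dvd // dvdp_XsubCl root_gcd andb_idl // rootP => /existsP [j].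
  rewrite factorE => /eqP ->.
  have [k nE] := dvdnP e_dvd.
  rewrite rootE !hornerE subr_eq0 nE mulnC exprM zetaX.
  rewrite -[_ ^+ e](root_of_unityX R e _ e%:Z).
  have /eqP -> : root_of_unity R e (- dwork_shift lam j * e%:Z) == 1.
    by rewrite root_of_unity_eq1 // dvdz_mull.
  by rewrite expr1n.
rewrite -rootP -mup_root.
by case: (mup _ _) mup_le1 => [|[|k]].
Qed.
End Multiplicity.

(** * Balanced tuples as families of shifts *)

Section Reparametrization.
Variables (N' d e r : nat).
Notation N := N'.+1.
Hypotheses (d_gt0 : (0 < d)%N) (N_re : N = (r * e)%N).
Hypothesis e_gcd : e = gcdn N d.+1.

Let re_gt0 : (0 < r * e)%N. Proof. by rewrite -N_re. Qed.
Let r_gt0 : (0 < r)%N. Proof. by move: re_gt0; rewrite muln_gt0 => /andP []. Qed.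
Let e_gt0 : (0 < e)%N. Proof. by move: re_gt0; rewrite muln_gt0 => /andP []. Qed.

Definition shifted_family (lam : {ffun 'I_d.-1 -> 'I_e}) (m : 'I_N) :
    {ffun 'I_d.+1 -> 'I_N} :=
  [ffun i => m - char_class N' (r%:Z * dwork_shift lam i)].

Lemma shifted_family_last lam m : shifted_family lam m ord_max = m.
Proof. by rewrite ffunE dwork_shift_last // mulr0 subr0. Qed.

Lemma sum_shifted_family lam m : \sum_i shifted_family lam m i = m *+ d.+1.
Proof.
under eq_bigr do rewrite ffunE.
rewrite big_split /= sumr_const card_ord sumrN -char_class_sum -mulr_sumr.
by rewrite sum_dwork_shift // mulr0 subr0.
Qed.

Lemma balanced_shifted_family lam m : balanced (shifted_family lam m).
Proof.
apply/forallP => i; rewrite sum_shifted_family ffunE mulrnBl -subr_eq0 addrAC.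
rewrite subrr add0r oppr_eq0 -char_classMn char_class_eq0 N_re mulrAC PoszM.
by rewrite dvdz_mulr // dvdz_mul // dvdzE /= e_gcd dvdn_gcdr.
Qed.

(** With N = r e and n = b e, the assumption N %| x n reads r %| x b, where r and b are
    coprime because e is the gcd of N and n. *)
Lemma torsion_dvd (x : 'I_N) : x *+ d.+1 = 0 -> (r %| x)%N.
Proof.
move/eqP; rewrite Zp_mulrn -val_eqE /= -/(dvdn _ _) {1}N_re.
have /dvdnP [b nE] : (e %| d.+1)%N by rewrite e_gcd dvdn_gcdr.
rewrite nE mulnA dvdn_pmul2r // Gauss_dvdl //.
by rewrite /coprime -(eqn_pmul2r e_gt0) muln_gcdl -N_re -nE -e_gcd mul1n.
Qed.

Lemma div_r_ltn_e (x : 'I_N) : (x %/ r < e)%N.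
Proof. by rewrite ltn_divLR // mulnC -N_re. Qed.

(** The inverse of [shifted_family]: the last shift is 0, so that m is the last entry,
    and k_last - k_j = (N / e) lambda_j is divided by r = N / e. *)
Definition shift_of (k : {ffun 'I_d.+1 -> 'I_N}) : {ffun 'I_d.-1 -> 'I_e} :=
  [ffun j : 'I_d.-1 => Ordinal (div_r_ltn_e (k ord_max - k (inord j)))].

Lemma shift_ofE k j : shift_of k j = ((k ord_max - k (inord j))%R %/ r)%N :> nat.
Proof. by rewrite ffunE. Qed.

Lemma shifted_familyK lam m : shift_of (shifted_family lam m) = lam.
Proof.
apply/ffunP => j; apply: val_inj => /=; rewrite shift_ofE shifted_family_last ffunE.
have jE : (inord j : 'I_d.+1) = j :> nat.
  by rewrite inordK // ltnS ltnW // (leq_trans (ltn_ord j)) ?leq_pred.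
rewrite (dwork_shift_lam lam jE) opprB addrCA subrr addr0 -PoszM.
by rewrite char_class_nat /= modn_small ?mulKn // N_re ltn_pmul2l.
Qed.

(** The entries other than the last but one agree by [torsion_dvd]; the remaining one
    is determined by the sum of the entries, which is n k_last in both
    tuples. *)
Lemma shift_ofK k : balanced k -> shifted_family (shift_of k) (k ord_max) = k.
Proof.
set k' := shifted_family _ _ => /forallP bal.
have last_eq : k' ord_max = k ord_max by apply: shifted_family_last.
have lt_eq (i : 'I_d.+1) : (i < d.-1)%N -> k' i = k i.
  move=> i_lt; rewrite ffunE (dwork_shift_lam _ (j := Ordinal i_lt)) //.
  have -> : (shift_of k (Ordinal i_lt))%:Z = ((k ord_max - k i)%R %/ r)%N%:Z.
    by rewrite shift_ofE inord_val.
  rewrite -PoszM mulnC divnK ?char_class_ord ?subKr //.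
  by apply: torsion_dvd; rewrite mulrnBl (eqP (bal i)) (eqP (bal ord_max)) subrr.
apply/ffunP => i; case: (ltngtP i d.-1) => [|i_gt|i_eq]; first exact: lt_eq.
  suff -> : i = ord_max by [].
  apply: val_inj => /=; apply/eqP; rewrite eqn_leq -ltnS ltn_ord /=.
  by rewrite prednK in i_gt.
have : \sum_i k' i = \sum_i k i.
  by rewrite sum_shifted_family (eqP (bal ord_max)).
rewrite (bigD1 i) //= [RHS](bigD1 i) //= (eq_bigr k); first exact: addIr.
move=> j ji; case: (ltngtP j d.-1) => [|j_gt|j_eq]; first exact: lt_eq.
  suff -> : j = ord_max by [].
  apply: val_inj => /=; apply/eqP; rewrite eqn_leq -ltnS ltn_ord /=.
  by rewrite prednK in j_gt.
by case/eqP: ji; apply: ord_inj; rewrite i_eq j_eq.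
Qed.

Lemma sum_balanced (C : zmodType) (h : {ffun 'I_d.+1 -> 'I_N} -> C) :
  \sum_(k | balanced k) h k = \sum_lam \sum_m h (shifted_family lam m).
Proof.
rewrite pair_big /= (reindex (fun p => shifted_family p.1 p.2)) /=.
  by apply: eq_bigl => p; rewrite balanced_shifted_family.
exists (fun k => (shift_of k, k ord_max)) => [[lam m] _|k bal] /=.
  by rewrite shifted_familyK shifted_family_last.
exact: shift_ofK.
Qed.

End Reparametrization.

(** * The hypergeometric sum attached to one family of shifts *)

Lemma natr_neq0_coprime_card (F : finFieldType) n :
  coprime #|F| n -> n%:R != 0 :> F.
Proof.
have card0 : #|F|%:R = 0 :> F.
  have : \sum_(x : F) (1 + x) = \sum_(x : F) x.
    by rewrite [RHS](reindex_inj (addrI 1)).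
  by rewrite big_split /= sumr_const => /(canRL (addrK _)); rewrite subrr.
have F_gt0 : (0 < #|F|)%N by apply/card_gt0P; exists 0.
case/(coprimeP _ F_gt0) => -[a b] /= ab.
apply/negP => /eqP n0; have /eqP := oner_neq0 F; apply.
rewrite -[1]/(1%:R) -ab natrB; last by apply: ltnW; rewrite -subn_gt0 ab.
by rewrite !natrM card0 n0 !mulr0 subrr.
Qed.

Section HypergeometricTerm.
Variables (R : realType) (F : finFieldType) (psi chi : F -> R[i]).
Variables (N' d e : nat) (u : F).
Notation N := N'.+1.
Hypotheses (psi_char : additive_char psi) (psi_nontrivial : nontrivial_char psi).
Hypotheses (chi_char : multiplicative_char chi) (chi_order : has_char_order chi N).
Hypotheses (d_gt0 : (0 < d)%N) (cardF : #|F| = N.+1).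
Hypotheses (N_coprime : coprime N.+1 d.+1) (e_gcd : e = gcdn N d.+1) (u_neq0 : u != 0).

Let e_gt0 : (0 < e)%N. Proof. by rewrite e_gcd gcdn_gt0. Qed.
Let N_re : N = (N %/ e * e)%N. Proof. by rewrite divnK // e_gcd dvdn_gcdl. Qed.
Let r_gt0 : (0 < N %/ e)%N.
Proof. by rewrite divn_gt0 // e_gcd dvdn_leq // dvdn_gcdl. Qed.

Lemma dwork_gamma_gamma :
  gamma_gamma (@dwork_gamma d) F * u ^+ d.+1 = (- (u^-1 * d.+1%:R)) ^- d.+1.
Proof.
have -> : gamma_gamma (@dwork_gamma d) F = (- d.+1%:R) ^- d.+1.
  rewrite /gamma_gamma big_ord_recl big1 => [|i _]; last by rewrite exp1rz.
  by rewrite mulr1 /dwork_gamma eqxx intrN exprnN.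
by rewrite -!exprVn -exprMn -mulrN invfM invrK mulrC.
Qed.

(** The Gauss sum of index 0 that is the first entry of the denominator and the other
    entries cancel against the factor in front. In the numerator, - gamma_0 m = n m
    is the sum of the k_i, and the character at gamma^gamma u^n = (- c)^(- n) is
    the one of index - n m at - c. *)
Lemma hypergeometric_term (lam : {ffun 'I_d.-1 -> 'I_e}) :
  gauss_prod psi chi (fun j => (N %/ e)%N%:Z * dwork_delta lam j) *
  finite_hypergeometric (@dwork_gamma d) (dwork_delta lam) e psi chi (u ^+ d.+1) =
  (1 - N.+1%:R)^-1 * N.+1%:R^-1 * \sum_(m : 'I_N)
    let k := shifted_family (N %/ e) lam m in
    gauss_summand chi psi (u^-1 * d.+1%:R) k * N.+1%:R ^+ [exists i, k i == 0].
Proof.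
have q0 : N.+1%:R != 0 :> R[i] by rewrite pnatr_eq0.
rewrite /finite_hypergeometric cardF /= mulrCA -mulrA; congr (_ * _).
rewrite !mulr_sumr big_mkord; apply: eq_bigr => m _.
set k := shifted_family _ _ _.
set g := gauss_prod _ _ (fun j => _ * _).
have -> : gauss_prod psi chi (scaled_delta (dwork_delta lam) e F) = g.
  by apply: eq_bigr => j _; rewrite /scaled_delta cardF mulrC.
have g0 : g != 0.
  apply/prodf_neq0 => j _.
  by rewrite (gauss_sum_class chi_char chi_order) (gauss_neq0 cardF).
have classE i : char_class N' (- 1 * m%:Z + dwork_shift lam i * (N %/ e)%N%:Z) = - k i.
  by rewrite ffunE char_classD mulN1r char_classN char_class_ord opprB addrC mulrC.
have kE i : (k i == 0) =
    ((N %/ e * e)%N %| - m%:Z + (N %/ e)%N%:Z * dwork_shift lam i)%Z.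
  by rewrite -N_re -(char_class_eq0 N') -oppr_eq0 -classE mulN1r mulrC.
have e_dvd : (e %| d.+1)%N by rewrite e_gcd dvdn_gcdr.
have s_E : s_mult (@dwork_gamma d) (dwork_delta lam) e R N.+1 (- m%:Z) =
    [exists i, k i == 0].
  rewrite {1}N_re s_mult_dwork //.
  by congr nat_of_bool; apply: eq_existsb => i; rewrite kE.
have s0_E : s_mult (@dwork_gamma d) (dwork_delta lam) e R N.+1 0 = 1%N.
  rewrite {1}N_re s_mult_dwork //.
  (* The last shift is 0. *)
  case: existsP => // -[]; exists ord_max.
  by rewrite dwork_shift_last // mulr0 addr0 dvdz0.
rewrite s_E s0_E.
have -> : gauss_prod psi chi (fun j => - dwork_gamma j * m%:Z +
    scaled_delta (dwork_delta lam) e F j) =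
    gauss chi psi (\sum_i k i) * \prod_i gauss chi psi (- k i).
  rewrite /gauss_prod big_ord_recl; congr (_ * _).
    rewrite (gauss_sum_class chi_char chi_order) /scaled_delta dwork_delta_ord0.
    rewrite mul0r addr0 /dwork_gamma eqxx opprK mulrC char_classMn char_class_ord.
    by rewrite sum_shifted_family.
  apply: eq_bigr => i _; rewrite (gauss_sum_class chi_char chi_order).
  by rewrite -classE /scaled_delta cardF.
have chiE : chi (gamma_gamma (@dwork_gamma d) F * u ^+ d.+1) ^+ m =
    mchar chi (- \sum_i k i) (- (u^-1 * d.+1%:R)).
  rewrite dwork_gamma_gamma sum_shifted_family //.
  have c0 : - (u^-1 * d.+1%:R) != 0.
    by rewrite oppr_eq0 mulf_neq0 ?invr_neq0 ?natr_neq0_coprime_card ?cardF.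
  rewrite -/(mchar chi m _) (mcharV chi_char) ?expf_neq0 //.
  by rewrite (mcharX chi_char chi_order) // (mcharN chi_char chi_order).
rewrite chiE /gauss_summand /= expfzDr // -exprnP exprN1.
set q := N.+1%:R in q0 *; clearbody q.
by field; rewrite q0 g0.
Qed.
End HypergeometricTerm.

Theorem theorem1p9 (R : realType) (F : finFieldType) (psi chi : F -> R[i])
    (d q e : nat) (u : F)
    (psi_char : additive_char psi) (psi_nontrivial : nontrivial_char psi)
    (chi_char : multiplicative_char chi) (chi_order : has_char_order chi q.-1)
    (d_ge1 : (1 <= d)%N) (qE : q = #|F|) (q_coprime : coprime q d.+1)
    (eE : e = gcdn q.-1 d.+1) (u_neq0 : u != 0) :
  #|dwork_points d u|%:R =
    (q%:R ^+ d - 1) / (q%:R - 1)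
    - \sum_(lam : {ffun 'I_d.-1 -> 'I_e})
        gauss_prod psi chi
          (fun j => (q.-1 %/ e)%N%:Z * dwork_delta lam j)
        * finite_hypergeometric (@dwork_gamma d) (dwork_delta lam) e psi chi
            (u ^+ d.+1)
  :> R[i].
Proof.
have q_gt1 : (1 < q)%N by rewrite qE finNzRing_gt1.
case: q => [|[|N']] // in qE q_gt1 chi_order q_coprime eE *.
rewrite [_.-1]/= in chi_order eE *.
have cardF := esym qE; set N := N'.+1 in chi_order eE cardF q_coprime qE *.
have N_re : N = (N %/ e * e)%N by rewrite divnK // eE dvdn_gcdl.
have c0 : u^-1 * d.+1%:R != 0.
  by rewrite mulf_neq0 ?invr_neq0 // natr_neq0_coprime_card // cardF.
under eq_bigr do rewrite (hypergeometric_term psi_char psi_nontrivial chi_char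
  chi_order d_ge1 cardF q_coprime eE u_neq0).
rewrite -mulr_sumr -(sum_balanced d_ge1 N_re eE (fun k =>
  gauss_summand chi psi (u^-1 * d.+1%:R) k * N.+1%:R ^+ [exists i, k i == 0])).
have := card_form_zeros cardF chi_char chi_order psi_char psi_nontrivial
  (ltn0Sn d) c0.
rewrite -card_dwork_points cardF -[(_ * _).+1%:R]natr1 natrM /=.
set W := \sum_(k | _) _ => zeros.
set P := (#|dwork_points d u|%:R : R[i]) in zeros *.
have NR0 : N%:R != 0 :> R[i] by rewrite pnatr_eq0.
have qR0 : N.+1%:R != 0 :> R[i] by rewrite pnatr_eq0.
(* q (P N + 1) = q^(d + 1) + W, solved for P. *)
have PE : P = (N.+1%:R ^+ d - 1) / N%:R + W / (N.+1%:R * N%:R).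
  apply: (mulIf NR0); apply: (mulfI qR0).
  move: zeros; rewrite mulrDr mulr1 => /(canRL (addrK _)) ->; rewrite exprS.
  set v : R[i] := N%:R in NR0 *; set w : R[i] := N.+1%:R in qR0 *; clearbody v w.
  by field; rewrite qR0 NR0.
have -> : N.+1%:R - 1 = N%:R :> R[i] by rewrite -natr1 addrK.
have -> : 1 - N.+1%:R = - N%:R :> R[i] by rewrite -natr1 opprD addrCA subrr addr0.
rewrite PE invrN !mulNr opprK invfM; congr (_ + _).
by rewrite mulrC [_^-1 * _^-1]mulrC.
Qed.
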